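(* Let $p$ be a prime. Consider the subring $R=\mathbb{F}_p\bigl[\alpha,\beta,\bigl((\alpha+\beta)^{p-1}-1\bigr)^{-1}\bigr]$ of the field $\mathbb{F}_p(\alpha,\beta)$ of rational expressions in the indeterminates $\alpha$ and $\beta$, and let $X$ and $Y$ be further indeterminates. There exist rational expressions $c_i(\alpha,\beta)\in R$, for $0\le i\le p-1$, such that \[ L_{p-1}^{(\alpha)}(X)\,L_{p-1}^{(\beta)}(Y)\equiv L_{p-1}^{(\alpha+\beta)}(X+Y)\Bigl(c_0(\alpha,\beta)+\sum_{i=1}^{p-1}c_i(\alpha,\beta)X^iY^{p-i}\Bigr) \] in $R[X,Y]$, modulo the ideal of $R[X,Y]$ generated by $X^p-(\alpha^p-\alpha)$ and $Y^p-(\beta^p-\beta)$.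
   Context: The (generalized) Laguerre polynomial of degree $n$ is $L_n^{(\alpha)}(X)=\sum_{k=0}^n\binom{\alpha+n}{n-k}\frac{(-X)^k}{k!}$, viewed as a polynomial in the two indeterminates $\alpha$ and $X$ with rational coefficients. For $n=p-1$ the coefficients have denominators prime to $p$, and $L_{p-1}^{(\alpha)}(X)$ is viewed, by reduction modulo $p$, as a polynomial in $\alpha$ and $X$ with coefficients in the field $\mathbb{F}_p$ of $p$ elements. $L_{p-1}^{(\beta)}(Y)$ and $L_{p-1}^{(\alpha+\beta)}(X+Y)$ are obtained by substituting for the two indeterminates. *)

(* Defs.v *)
From HB Require Import structures.
From mathcomp Require Import all_boot all_order all_algebra.
From mathcomp Require Import fraction.
From mathcomp Require Import mpoly.

Set Implicit Arguments.
Unset Strict Implicit.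
Unset Printing Implicit Defensive.

Import GRing.Theory.
Local Open Scope ring_scope.

(* a (a - 1) ... (a - k + 1) / k! *)
Definition gbinom (A : comAlgType rat) (a : A) (k : nat) : A :=
  (k`!%:R^-1 : rat) *: \prod_(j < k) (a - j%:R).

(* The first variable is alpha, the second one is X. *)
Definition laguerre (n : nat) : {mpoly rat[2]} :=
  \sum_(k < n.+1)
     gbinom ('X_ord0 + n%:R) (n - k) * ((k`!%:R^-1 : rat) *: (- 'X_ord_max) ^+ k).

(* [ratr] into 'F_p sends a fraction in lowest terms a / b to a * b^-1; this is
   reduction modulo p on the rationals with denominator prime to p, among which
   are all the coefficients of [laguerre p.-1]. *)
Definition laguerre_modp (p : nat) : {mpoly 'F_p[2]} :=
  map_mpoly (ratr : rat -> 'F_p) (laguerre p.-1).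

Definition ratfun (p : nat) : fieldType := {fraction {mpoly 'F_p[2]}}.

Definition ratfunC (p : nat) (a : 'F_p) : ratfun p := tofrac (a%:MP_[2]).
Definition ralpha (p : nat) : ratfun p := tofrac ('X_ord0 : {mpoly 'F_p[2]}).
Definition rbeta (p : nat) : ratfun p := tofrac ('X_ord_max : {mpoly 'F_p[2]}).

(* The values at (alpha, beta, ((alpha + beta)^(p - 1) - 1)^-1) of the
   polynomials in three variables over 'F_p. *)
Definition in_R (p : nat) (x : ratfun p) : Prop :=
  exists q : {mpoly 'F_p[3]},
    x = mmap (@ratfunC p)
          (tnth [tuple ralpha p; rbeta p; ((ralpha p + rbeta p) ^+ p.-1 - 1)^-1])
          q.

(* R[X, Y], inside the polynomial ring over the field of fractions of R. *)
Definition in_RXY (p : nat) (f : {mpoly (ratfun p)[2]}) : Prop :=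
  forall m : 'X_{1..2}, in_R f@_m.

Definition polX (p : nat) : {mpoly (ratfun p)[2]} := 'X_ord0.
Definition polY (p : nat) : {mpoly (ratfun p)[2]} := 'X_ord_max.

(* The substitution (alpha, X) := (a, x) in L_{p-1}^{(alpha)}(X). *)
Definition laguerre_at (p : nat) (a : ratfun p) (x : {mpoly (ratfun p)[2]}) :
    {mpoly (ratfun p)[2]} :=
  mmap (fun c : 'F_p => (ratfunC c)%:MP_[2]) (tnth [tuple a%:MP_[2]; x])
    (laguerre_modp p).

(* Congruence in R[X, Y] modulo the ideal of R[X, Y] generated by g and h. *)
Definition congr_RXY (p : nat) (g h f1 f2 : {mpoly (ratfun p)[2]}) : Prop :=
  [/\ in_RXY f1, in_RXY f2 &
      exists u v : {mpoly (ratfun p)[2]},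
        [/\ in_RXY u, in_RXY v & f1 - f2 = u * g + v * h]].

(* Main.v *)
Require Import Defs.
From HB Require Import structures.
From mathcomp Require Import all_boot all_order all_algebra.
From mathcomp Require Import fraction.
From mathcomp Require Import mpoly.
From mathcomp Require Import finfield zify ring.
Import GRing.Theory.
Import Num.Theory.
Local Open Scope ring_scope.

Set Implicit Arguments.
Unset Strict Implicit.
Unset Printing Implicit Defensive.

(** Modulo p the Laguerre polynomial of degree p - 1 is
      L(a, x) = - sum_(k < p) (a - 1) (a - 2) ... (a - (p - 1 - k)) x^k
    ([laguerre_modpE]), and this formula makes sense in every commutative ring
    of characteristic p. Two properties of L carry the proof.

    The first is a differential equation ([der_lag]): if D is a derivation with
    D a = 0 and D x = x, then D L(a, x) = (x - a) L(a, x) + (x^p - (a^p - a)).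
    So modulo x^p - (a^p - a) the polynomial L(a, x) behaves like the product
    of x^(-a) and exp x.

    The second is an inversion formula ([lag_mul_opp]): modulo
    x^p - (c^p - c), the product L(c, x) L(-c, -x) is the scalar 1 - c^(p-1).
    Indeed the differential equation shows that x d/dx kills the product modulo
    x^p - (c^p - c). On polynomials in x, the (p - 1)-st power of x d/dx
    multiplies x^k by k^(p-1), which is 0 if p divides k and 1 otherwise; hence
    the product is congruent to its part of degrees divisible by p, and the two
    coefficients left (in degrees 0 and p) are computed from
    (c - 1) ... (c - (p - 1)) = c^(p-1) - 1 and from the derivative of this
    identity.

    Now let F = L(a, X) L(b, Y), G = L(a + b, X + Y) and
    H = L(-(a + b), -(X + Y)). The ideal generated by X^p - (a^p - a) and
    Y^p - (b^p - b) contains (X + Y)^p - ((a + b)^p - (a + b)), so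
    G H = 1 - (a + b)^(p-1) modulo the ideal. The Euler operator
    X d/dX + Y d/dY kills F H modulo the ideal, because the logarithmic
    derivatives X - a, Y - b and -(X + Y) + (a + b) add up to 0. As above, F H is
    then congruent to its part of total degrees divisible by p, that is, to a
    combination N of 1 and of the X^i Y^(p-i) with 0 < i < p
    ([meuler_diag_form]). Hence (1 - (a + b)^(p-1)) F = G N modulo the ideal,
    with coefficients in F_p[a, b] ([lag_mul_addition]); the theorem follows
    by dividing by 1 - (a + b)^(p-1), which is a unit of R. *)

(** * Products and powers in characteristic p *)

Lemma pchar_natrN (T : comNzRingType) (p k : nat) :
  p \in [pchar T] -> (k <= p)%N -> (p - k)%:R = - k%:R :> T.
Proof. by move=> pT le_kp; rewrite natrB // pcharf0 // sub0r. Qed.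

Lemma prod_subr_nat_pchar (T : comNzRingType) (p : nat) (a : T) :
  p \in [pchar T] -> \prod_(i < p) (a - i%:R) = a ^+ p - a.
Proof.
move=> pT; have p_pr := pcharf_prime pT.
(* Transport from 'F_p, over which T is an algebra. *)
pose f := in_alg (pPrimeCharType pT) : {rmorphism 'F_p -> _}.
have /(congr1 (fun q => (map_poly f q).[a : pPrimeCharType pT])) :=
  finField_genPoly 'F_p.
rewrite card_Fp // rmorphB rmorph_prod rmorphXn /= map_polyX !hornerE /=.
rewrite horner_prod => ->.
have -> : \prod_(i < p) (a - i%:R) =
    \prod_(i < (Zp_trunc (pdiv p)).+2) (a - i%:R) by rewrite Fp_cast.
apply: eq_bigr => i _; rewrite map_polyXsubC hornerXsubC; congr (_ - _).
by rewrite -[i in RHS]natr_Zp rmorph_nat.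
Qed.

Lemma natrXp1_pchar (T : comNzRingType) (p n : nat) :
  p \in [pchar T] -> (n%:R : T) ^+ p.-1 = (~~ (p %| n)%N)%:R.
Proof.
move=> pT; have p_pr := pcharf_prime pT.
case: (boolP (p %| n)%N) => [pn | pn].
  rewrite (_ : n%:R = 0) ?expr0n /=; first by case: (p) p_pr => [|[]].
  by apply/eqP; rewrite -(dvdn_pcharf pT).
pose f := in_alg (pPrimeCharType pT) : {rmorphism 'F_p -> _}.
have -> : (n%:R : T) = f n%:R by rewrite rmorph_nat.
rewrite -rmorphXn /= (_ : n%:R ^+ p.-1 = 1) ?scale1r //.
apply: (@mulfI _ n%:R); first by rewrite -(dvdn_pcharf (pchar_Fp p_pr)).
by rewrite -exprS prednK ?prime_gt0 // mulr1 -[p in _ ^+ p](card_Fp p_pr) expf_card.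
Qed.

Lemma prod_subr_natS_pchar (T : comNzRingType) (p : nat) (a : T) :
  p \in [pchar T] -> \prod_(i < p.-1) (a - i.+1%:R) = a ^+ p.-1 - 1.
Proof.
move=> pT; have p_gt0 := prime_gt0 (pcharf_prime pT).
suff PE : \prod_(i < p.-1) ('X - i.+1%:R) = 'X^(p.-1) - 1 :> {poly T}.
  have := congr1 (horner^~ a) PE; rewrite horner_prod !hornerE => <-.
  by apply: eq_bigr => i _; rewrite !hornerE -polyC_natr hornerC.
apply: (lreg_lead (p := 'X)); first by rewrite lead_coefX; apply: lreg1.
have pP : p \in [pchar {poly T}] by rewrite pchar_poly.
rewrite mulrBr mulr1 -exprS prednK // -(prod_subr_nat_pchar _ pP).
by rewrite -[p in RHS](prednK p_gt0) big_ord_recl subr0.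
Qed.

Lemma deriv_prod (R : comNzRingType) (n : nat) (F : 'I_n -> {poly R}) :
  (\prod_i F i)^`() = \sum_i (F i)^`() * \prod_(j | j != i) F j.
Proof.
elim: n F => [|n IHn] F; first by rewrite !big_ord0 derivC.
rewrite !big_ord_recl derivM IHn mulr_sumr; congr (_ * _ + _).
  by rewrite [RHS]big_mkcond big_ord_recl /= mul1r.
apply: eq_bigr => i _; rewrite [in RHS]big_mkcond big_ord_recl /=.
rewrite mulrCA; congr (_ * (_ * _)).
by rewrite [LHS]big_mkcond.
Qed.

(** The derivative of the identity [prod_subr_natS_pchar]. *)
Lemma sum_prod_subr_natS_pchar (T : comNzRingType) (p : nat) (a : T) :
  p \in [pchar T] ->
  \sum_(i < p.-1) \prod_(j < p.-1 | j != i) (a - j.+1%:R) = - a ^+ p.-2.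
Proof.
move=> pT; have p_gt0 := prime_gt0 (pcharf_prime pT).
have pP : p \in [pchar {poly T}] by rewrite pchar_poly.
have := congr1 (fun q => q^`().[a]) (prod_subr_natS_pchar 'X pP).
rewrite deriv_prod horner_sum derivB derivXn derivC subr0.
rewrite hornerMn hornerXn -mulr_natr -subn1 (pchar_natrN pT) //.
rewrite mulrN mulr1 subn1 => <-; apply: eq_bigr => i _.
rewrite derivB derivX -polyC_natr derivC subr0 mul1r horner_prod.
by apply: eq_bigr => j _; rewrite !hornerE -polyC_natr hornerC.
Qed.

(** * The Laguerre polynomial in characteristic p and its differential equation *)

Section Laguerre.
Variables (p : nat) (T : comNzRingType).

(** Up to sign, the coefficient of x^k in the Laguerre polynomial of degree
    p - 1 and parameter a, reduced modulo p. *)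
Definition lagc (a : T) k := \prod_(l < p.-1 - k) (a - l.+1%:R).
(** The value at a and x of the Laguerre polynomial of degree p - 1, reduced
    modulo p. It is defined in any ring, so that every substitution for the two
    indeterminates is an instance of it. *)
Definition lag (a x : T) := - \sum_(k < p) lagc a k * x ^+ k.

Section Deriv.
Variable D : {additive T -> T}.
Hypothesis DM : forall x y, D (x * y) = D x * y + x * D y.
Hypothesis pT : p \in [pchar T].

Lemma der1 : D 1 = 0.
Proof.
by apply: (addrI (D 1)); have := DM 1 1; rewrite !mulr1 mul1r addr0 => <-.
Qed.

Lemma derX x n : D x = x -> D (x ^+ n) = x ^+ n *+ n.
Proof.
move=> Dx; elim: n => [|n IHn]; first by rewrite der1.
by rewrite exprS DM Dx IHn mulrnAr mulrS.
Qed.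

Lemma der_nat n : D n%:R = 0.
Proof. by rewrite raddfMn /= der1 mul0rn. Qed.

Lemma der_lagc a k : D a = 0 -> D (lagc a k) = 0.
Proof.
move=> Da; rewrite /lagc; apply: (big_ind (fun x => D x = 0)) => [|x y Dx Dy|i _].
- exact: der1.
- by rewrite DM Dx Dy mul0r mulr0 addr0.
- by rewrite raddfB /= Da der_nat subrr.
Qed.

(** The coefficients satisfy a recurrence of order one, which turns the sum into
    a telescoping one; only the extreme terms x^p and a^p - a remain. *)
Lemma der_lag a x : D a = 0 -> D x = x ->
  D (lag a x) = (x - a) * lag a x + (x ^+ p - (a ^+ p - a)).
Proof.
move=> Da Dx; have p_gt0 := prime_gt0 (pcharf_prime pT).
rewrite /lag; rewrite raddfN raddf_sum /=.
have -> : \sum_(k < p) D (lagc a k * x ^+ k) =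
          \sum_(k < p) (lagc a k * x ^+ k *+ k).
  by apply: eq_bigr => k _; rewrite DM der_lagc // mul0r add0r derX // mulrnAr.
have dS k : (k.+1 < p)%N -> lagc a k = lagc a k.+1 * (a + k.+1%:R).
  move=> lt_kp; rewrite /lagc (_ : p.-1 - k = (p.-1 - k.+1).+1)%N; last first.
    by rewrite -subSn // -ltnS prednK.
  rewrite big_ord_recr /=; congr (_ * (a + _)).
  rewrite (_ : (p.-1 - k.+1).+1 = p - k.+1)%N; last first.
    by rewrite -subSn ?prednK // -ltnS prednK.
  by rewrite (pchar_natrN pT) ?opprK // ltnW.
have d0 : a * lagc a 0 = a ^+ p - a.
  rewrite /lagc subn0 prod_subr_natS_pchar // mulrBr mulr1 -exprS prednK //.
have dp : lagc a p.-1 = 1 by rewrite /lagc subnn big_ord0.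
have Ha : a * (\sum_(k < p) lagc a k * x ^+ k) + \sum_(k < p) (lagc a k * x ^+ k *+ k)
   = x * (\sum_(k < p) lagc a k * x ^+ k) - x ^+ p + (a ^+ p - a).
  rewrite mulr_sumr -big_split /= -d0.
  move: dS dp; case: (p) p_gt0 => // q _ dS dp.
  rewrite [in LHS]big_ord_recl big_ord_recr /= mulr0n addr0 expr0 mulr1 dp.
  rewrite mul1r mulrDr -exprS addrK addrC; congr (_ + _).
  rewrite mulr_sumr; apply: eq_bigr => i _.
  rewrite (dS i) ?ltnS // /bump leq0n add1n exprS -mulr_natr; ring.
move: Ha; set S := \sum_(k < p) _; set S' := \sum_(k < p) _ => Ha.
have -> : S = a * S' + S - a * S' by ring.
rewrite Ha; ring.
Qed.
End Deriv.
End Laguerre.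

Lemma rmorph_lag (p : nat) (S T : comNzRingType) (f : {rmorphism S -> T}) (a x : S) :
  f (lag p a x) = lag p (f a) (f x).
Proof.
rewrite rmorphN rmorph_sum; congr (- _); apply: eq_bigr => k _.
rewrite rmorphM rmorphXn rmorph_prod; congr (_ * _).
by apply: eq_bigr => l _; rewrite rmorphB rmorph_nat.
Qed.

(** * Ideals with two generators *)

Section Ideal2.
Variable T : comNzRingType.
Implicit Types g h x y z : T.

(** Membership in the ideal generated by g and h. *)
Definition idl g h x := exists u v, x = u * g + v * h.
(** Congruence modulo the ideal generated by g and h. *)
Definition idl_eq g h x y := idl g h (x - y).

Lemma idl0 g h : idl g h 0.
Proof. by exists 0, 0; rewrite !mul0r addr0. Qed.

Lemma idlD g h x y : idl g h x -> idl g h y -> idl g h (x + y).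
Proof. by move=> [u [v ->]] [u' [v' ->]]; exists (u + u'), (v + v'); ring. Qed.

Lemma idlMl g h x y : idl g h y -> idl g h (x * y).
Proof. by move=> [u [v ->]]; exists (x * u), (x * v); ring. Qed.

Lemma idl_eq_refl g h x : idl_eq g h x x.
Proof. by rewrite /idl_eq subrr; apply: idl0. Qed.

Lemma idl_eq_trans g h x y z : idl_eq g h x y -> idl_eq g h y z -> idl_eq g h x z.
Proof.
move=> H1 H2; rewrite /idl_eq (_ : x - z = (x - y) + (y - z)); last by ring.
exact: idlD.
Qed.

Lemma idl_eqD g h x y x' y' :
  idl_eq g h x y -> idl_eq g h x' y' -> idl_eq g h (x + x') (y + y').
Proof.
move=> H1 H2; rewrite /idl_eq (_ : _ - _ = (x - y) + (x' - y')); last by ring.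
exact: idlD.
Qed.

Lemma idl_eqM g h x y x' y' :
  idl_eq g h x y -> idl_eq g h x' y' -> idl_eq g h (x * x') (y * y').
Proof.
move=> H1 H2; rewrite /idl_eq (_ : _ - _ = x' * (x - y) + y * (x' - y')); last by ring.
by apply: idlD; apply: idlMl.
Qed.

Lemma idl_eqX g h x y n : idl_eq g h x y -> idl_eq g h (x ^+ n) (y ^+ n).
Proof.
move=> H; elim: n => [|n IHn]; first exact: idl_eq_refl.
by rewrite !exprS; apply: idl_eqM.
Qed.

(** A derivation that kills the generators preserves the ideal. *)
Lemma idl_der (D : {additive T -> T}) g h x :
  (forall x y, D (x * y) = D x * y + x * D y) -> D g = 0 -> D h = 0 ->
  idl g h x -> idl g h (D x).
Proof.
move=> DM Dg Dh [u [v ->]]; exists (D u), (D v).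
by rewrite raddfD /= !DM Dg Dh !mulr0 !addr0.
Qed.

Lemma idl_iter_der (D : {additive T -> T}) g h x n :
  (forall x y, D (x * y) = D x * y + x * D y) -> D g = 0 -> D h = 0 ->
  (0 < n)%N -> idl g h (D x) -> idl g h (iter n D x).
Proof.
move=> DM Dg Dh; case: n => // n _ Dx; elim: n => //= n IHn.
exact: idl_der.
Qed.
End Ideal2.

(** * The inversion formula *)

Section UniEuler.
Variable A : comNzRingType.

(** The derivation x d/dx of polynomials in x. *)
Definition poly_euler (q : {poly A}) : {poly A} := 'X * q^`().

Lemma poly_euler_is_zmod_morphism : zmod_morphism poly_euler.
Proof. by move=> q r; rewrite /poly_euler derivB mulrBr. Qed.

HB.instance Definition _ :=
  GRing.isZmodMorphism.Build _ _ poly_euler poly_euler_is_zmod_morphism.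

Lemma poly_eulerM q r : poly_euler (q * r) = poly_euler q * r + q * poly_euler r.
Proof. by rewrite /poly_euler derivM; ring. Qed.

Lemma poly_eulerC c : poly_euler c%:P = 0.
Proof. by rewrite /poly_euler derivC mulr0. Qed.

Lemma poly_eulerX : poly_euler 'X = 'X.
Proof. by rewrite /poly_euler derivX mulr1. Qed.

Lemma coef_poly_euler q i : (poly_euler q)`_i = q`_i *+ i.
Proof. by rewrite /poly_euler coefXM coef_deriv; case: i. Qed.

Lemma coef_iter_poly_euler q k i : (iter k poly_euler q)`_i = q`_i * i%:R ^+ k.
Proof.
elim: k => [|k IHk] /=; first by rewrite mulr1.
by rewrite coef_poly_euler IHk exprSr mulrA mulr_natr.
Qed.
End UniEuler.

Section LagUni.
Variables (p : nat) (A : comNzRingType) (pA : p \in [pchar A]) (c : A).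
Let p_pr := pcharf_prime pA.
Let p_gt0 := prime_gt0 p_pr.

(** Valid also for p = 2, where -1 = 1. *)
Lemma signr_pred_pchar : (-1) ^+ p.-1 = 1 :> A.
Proof.
have -> : -1 = p.-1%:R :> A by rewrite -subn1 (pchar_natrN pA).
rewrite natrXp1_pchar // gtnNdvd ?prednK //.
by rewrite -ltnS prednK // prime_gt1.
Qed.

Lemma lagc_polyC (d : A) k : lagc p d%:P k = (lagc p d k)%:P.
Proof.
by rewrite rmorph_prod; apply: eq_bigr => l _; rewrite rmorphB rmorph_nat.
Qed.

Lemma lag_polyX (d : A) : lag p d%:P 'X = \poly_(k < p) - lagc p d k.
Proof.
rewrite /lag poly_def -sumrN; apply: eq_bigr => k _.
by rewrite lagc_polyC mul_polyC scaleNr.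
Qed.

Lemma lag_polyNX (d : A) : lag p d%:P (- 'X) = \poly_(k < p) - ((-1) ^+ k * lagc p d k).
Proof.
rewrite /lag poly_def -sumrN; apply: eq_bigr => k _.
rewrite lagc_polyC (exprNn 'X) scaleNr -mul_polyC polyCM rmorphXn rmorphN1.
by rewrite mulrCA mulrA.
Qed.

(** The coefficient of x^(j+1) in L(c, x) times that of x^(p-1-j) in L(-c, -x):
    the second one is, up to sign, a product of the c + l = c - (p - l) with
    1 <= l <= j, and all the factors c - 1, ..., c - (p - 1) but one occur in
    the product of the two. *)
Lemma lagcM_opp (j : 'I_p.-1) :
  lagc p c j.+1 * ((-1) ^+ (p.-1 - j) * lagc p (- c) (p.-1 - j)) =
  \prod_(l < p.-1 | l != rev_ord j) (c - l.+1%:R).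
Proof.
have lt_j := ltn_ord j; have le_j := ltnW lt_j; pose F l := c - l.+1%:R.
rewrite /lagc (subKn le_j).
have -> : \prod_(l < p.-1 | l != rev_ord j) F l =
   \prod_(0 <= l < p.-1 | (l != p.-1 - j.+1)%N) F l by rewrite big_mkord.
have le1 : (p.-1 - j.+1 <= p.-1)%N by apply: leq_subr.
rewrite (big_cat_nat (leq0n _) le1) //=; congr (_ * _).
  rewrite -(big_mkord predT F) [LHS]big_nat_cond [RHS]big_nat_cond.
  by apply: eq_bigl => l; rewrite leq0n /=; case: ltngtP.
rewrite big_ltn_cond ?eqxx /=; last by rewrite -subn_gt0 subKn.
rewrite -subSn // subSS.
have -> : \prod_(p.-1 - j <= l < p.-1 | (l != p.-1 - j.+1)%N) F l
        = \prod_(p.-1 - j <= l < p.-1) F l.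
  rewrite [LHS]big_nat_cond [RHS]big_nat_cond; apply: eq_bigl => l.
  rewrite andbT; case: (leqP (p.-1 - j)%N l) => //= le_l.
  have lt_l : (p.-1 - j.+1 < l)%N by rewrite subnSK.
  by rewrite (gtn_eqF lt_l) andbT.
rewrite -[(p.-1 - j)%N]add0n big_addn (subKn le_j) big_mkord add0n.
rewrite (reindex_inj rev_ord_inj) /=.
have sgn : (-1) ^+ (p.-1 - j) * (-1) ^+ j = 1 :> A.
  by rewrite -exprD (subnK le_j) signr_pred_pchar.
set Q := RHS; rewrite -[Q]mul1r -[X in X * Q]sgn -mulrA {}/Q; congr (_ * _).
have -> : (-1) ^+ j = \prod_(l < j) (-1) :> A by rewrite prodr_const card_ord.
rewrite -big_split /=.
apply: eq_bigr => l _; rewrite mulN1r /F.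
rewrite -opprD; congr (- (c + _)).
rewrite -(pchar_natrN pA) //; first by congr _%:R; have := ltn_ord l; lia.
by have := ltn_ord l; lia.
Qed.

(** The polynomial L(-c, -x) inverts L(c, x) up to the scalar 1 - c^(p-1). *)
Lemma lag_mul_opp :
  exists w, lag p c%:P 'X * lag p (- c)%:P (- 'X) =
    (1 - c ^+ p.-1)%:P + w * ('X^p - (c ^+ p - c)%:P).
Proof.
pose P := lag p c%:P 'X * lag p (- c)%:P (- 'X).
have pP : p \in [pchar {poly A}] by rewrite pchar_poly.
have EM := @poly_eulerM A.
have p1_gt0 : (0 < p.-1)%N by rewrite -ltnS prednK // prime_gt1.
have Xnp n : (n%:R : A) = 0 -> poly_euler ('X^n : {poly A}) = 0.
  move=> n0; rewrite (derX EM n (poly_eulerX A)).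
  by rewrite -mulr_natr -polyC_natr n0 mulr0.
have EP : idl ('X^p - (c ^+ p - c)%:P) 0 (poly_euler P).
  have NcP : (- c) ^+ p - - c = - (c ^+ p - c).
    rewrite exprNn -[in (-1) ^+ p](prednK p_gt0) exprS signr_pred_pchar; ring.
  have NXP : (- 'X) ^+ p = - 'X^p :> {poly A}.
    rewrite exprNn -[in (-1) ^+ p](prednK p_gt0) exprS.
    by rewrite -[X in X ^+ p.-1]polyCN -rmorphXn signr_pred_pchar; ring.
  exists (lag p (- c)%:P (- 'X) - lag p c%:P 'X), 0.
  have D1 := der_lag EM pP (poly_eulerC c) (poly_eulerX A).
  have NX : poly_euler (- 'X) = - 'X :> {poly A}.
    by rewrite raddfN; congr (- _); apply: poly_eulerX.
  have D2 := der_lag EM pP (poly_eulerC (- c)) NX.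
  have K1 : c%:P ^+ p - c%:P = (c ^+ p - c)%:P by rewrite rmorphB rmorphXn.
  have K2 : (- c)%:P ^+ p - (- c)%:P = - (c ^+ p - c)%:P.
    by rewrite -rmorphXn -rmorphB NcP rmorphN.
  by rewrite [LHS]EM D1 D2 K1 K2 NXP polyCN; ring.
have [w [w' Ew]] : idl ('X^p - (c ^+ p - c)%:P) 0 (iter p.-1 (@poly_euler A) P).
  apply: (idl_iter_der EM) => //; last by rewrite raddf0.
  by rewrite raddfB /= poly_eulerC subr0 Xnp // pcharf0.
(* The difference is the part of P of degrees divisible by p. *)
have P0 : P - iter p.-1 (@poly_euler A) P = (P`_0)%:P + P`_p *: 'X^p.
  apply/polyP => i; rewrite coefB coef_iter_poly_euler natrXp1_pchar //.
  rewrite coefD coefC coefZ coefXn.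
  have [-> | i_neq0] := eqVneq i 0%N.
    by rewrite dvdn0 mulr0 subr0 eq_sym gtn_eqF // mulr0 addr0.
  have [-> | i_neqp] := eqVneq i p; first by rewrite dvdnn mulr0 mulr1 subr0 add0r.
  case: (boolP (p %| i)%N) => [/dvdnP[k def_i] | _]; last first.
    by rewrite mulr1 subrr mulr0 addr0.
  rewrite !mulr0 subr0 addr0 nth_default //.
  apply: leq_trans (size_polyMleq _ _) _.
  rewrite lag_polyX lag_polyNX.
  apply: (@leq_trans (p + p)%N).
    by rewrite (leq_trans (leq_pred _)) // leq_add // size_poly.
  rewrite def_i addnn -mul2n leq_mul2r; apply/orP; right.
  by case: k def_i i_neq0 i_neqp => [|[|]] // ->; rewrite ?mul0n ?mul1n ?eqxx.
have lagc0 (d : A) : lagc p d 0 = d ^+ p.-1 - 1.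
  by rewrite /lagc subn0 prod_subr_natS_pchar.
have EP0 : P`_0 = (c ^+ p.-1 - 1) ^+ 2.
  rewrite /P coef0M lag_polyX lag_polyNX !coef_poly p_gt0 !lagc0.
  by rewrite (exprNn c) signr_pred_pchar; ring.
have Pp : P`_p = - c ^+ p.-2.
  rewrite /P lag_polyX lag_polyNX coefM.
  rewrite -(sum_prod_subr_natS_pchar c pA) [RHS](reindex_inj rev_ord_inj).
  rewrite big_ord_recr /= coef_poly ltnn mul0r addr0.
  rewrite -(big_mkord xpredT (fun i => (\poly_(k < p) - lagc p c k)`_i *
     (\poly_(k < p) - ((-1) ^+ k * lagc p (- c) k))`_(p - i))).
  rewrite -{1}(prednK p_gt0) big_nat_recl // subn0 [X in _ * X]coef_poly ltnn.
  rewrite mulr0 add0r big_mkord; apply: eq_bigr => j _.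
  have lt_j := ltn_ord j; have pj : (p - j.+1 = p.-1 - j)%N by lia.
  by rewrite !coef_poly !ifT ?mulrNN ?pj ?lagcM_opp //; lia.
have e : c ^+ p.-1 = c ^+ p.-2 * c by rewrite -exprSr prednK.
have ep : c ^+ p = c ^+ p.-2 * c * c by rewrite -e -exprSr prednK.
exists (w + (P`_p)%:P).
rewrite -/P -[LHS](subrK (iter p.-1 (@poly_euler A) P)) P0 Ew mulr0 addr0.
rewrite EP0 Pp -mul_polyC e ep expr2 !(polyCN, polyCB, polyCM).
set u := (c ^+ p.-2)%:P; ring.
Qed.
End LagUni.

(** * Euler operator and reduction in two variables *)

Section MEuler.
Variables (n : nat) (A : comNzRingType).

(** The Euler operator, which multiplies a monomial by its total degree. *)
Definition meuler (f : {mpoly A[n]}) : {mpoly A[n]} := \sum_i 'X_i * f^`M(i).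

Lemma meuler_is_zmod_morphism : zmod_morphism meuler.
Proof.
move=> f g; rewrite -sumrB; apply: eq_bigr => i _.
by rewrite mderivB mulrBr.
Qed.

HB.instance Definition _ :=
  GRing.isZmodMorphism.Build _ _ meuler meuler_is_zmod_morphism.

Lemma meulerM f g : meuler (f * g) = meuler f * g + f * meuler g.
Proof.
rewrite mulr_suml mulr_sumr -big_split; apply: eq_bigr => i _ /=.
by rewrite mderivM; ring.
Qed.

Lemma meulerC c : meuler c%:MP = 0.
Proof. by rewrite /meuler big1 // => i _; rewrite mderivC mulr0. Qed.

Lemma meulerXm m : meuler 'X_[m] = 'X_[m] *+ mdeg m.
Proof.
rewrite mdegE -sumrMnr; apply: eq_bigr => i _.
rewrite mderivX -scalerAr -mpolyXD -scaler_nat.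
have [-> | mi] := eqVneq (m i) 0%N; first by rewrite !scale0r.
congr (_ *: 'X_[_]); apply/mnmP => j; rewrite mnmDE mnmBE mnm1E.
by case: (eqVneq i j) mi => [<-|_]; lia.
Qed.

Lemma meulerXi i : meuler 'X_i = 'X_i.
Proof. by rewrite meulerXm mdeg1. Qed.

Lemma iter_meulerE k f :
  iter k meuler f =
  \sum_(m <- msupp f) (f@_m * (mdeg m)%:R ^+ k) *: 'X_[m].
Proof.
elim: k => [|k IHk] /=.
  by rewrite [LHS]mpolyE; apply: eq_bigr => m _; rewrite mulr1.
rewrite IHk raddf_sum; apply: eq_bigr => m _ /=.
rewrite -mul_mpolyC meulerM meulerC mul0r add0r meulerXm.
by rewrite -scaler_nat mul_mpolyC scalerA exprSr mulrA.
Qed.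
End MEuler.

Section Reduce.
Variables (p : nat) (T : comNzRingType) (x y a b : T).
Hypothesis p_gt1 : (1 < p)%N.
Let g := x ^+ p - a.
Let h := y ^+ p - b.

Lemma idl_eq_redX n m : idl_eq g h (x ^+ n * y ^+ m)
  (a ^+ (n %/ p) * b ^+ (m %/ p) * (x ^+ (n %% p) * y ^+ (m %% p))).
Proof.
have gE : idl_eq g h (x ^+ p) a by exists 1, 0; rewrite /g; ring.
have hE : idl_eq g h (y ^+ p) b by exists 0, 1; rewrite /h; ring.
rewrite {1}(divn_eq n p) {1}(divn_eq m p) !exprD ![(_ * p)%N]mulnC !exprM mulrACA.
by apply: idl_eqM; [apply: idl_eqM; apply: idl_eqX | apply: idl_eq_refl].
Qed.
End Reduce.

(** If the logarithmic derivatives of x, y and z modulo the ideal add up to 0,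
    then D kills x y z modulo the ideal. *)
Lemma idl_der_mul3 (T : comNzRingType) (D : {additive T -> T})
    (g h x y z u v : T) :
  (forall x y, D (x * y) = D x * y + x * D y) ->
  D x = u * x + g -> D y = v * y + h -> D z = - (u + v) * z - (g + h) ->
  idl g h (D (x * y * z)).
Proof.
move=> DM Dx Dy Dz; exists (y * z - x * y), (x * z - x * y).
by rewrite !DM Dx Dy Dz; ring.
Qed.

Section Bivariate.
Variables (p : nat) (A : comNzRingType) (pA : p \in [pchar A]) (a b : A).
Let p_pr := pcharf_prime pA.
Let p_gt0 := prime_gt0 p_pr.
Local Notation X := ('X_ord0 : {mpoly A[2]}).
Local Notation Y := ('X_ord_max : {mpoly A[2]}).
Let g := X ^+ p - (a ^+ p - a)%:MP.
Let h := Y ^+ p - (b ^+ p - b)%:MP.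

Let pM : p \in [pchar {mpoly A[2]}].
Proof. exact: (rmorph_pchar (@mpolyC 2 A)). Qed.

(** The combination of 1 and of the X^i Y^(p-i), 0 < i < p, with coefficients c. *)
Definition diag_form (c : nat -> A) : {mpoly A[2]} :=
  (c 0%N)%:MP + \sum_(1 <= i < p) (c i)%:MP * X ^+ i * Y ^+ (p - i).

Lemma diag_form0 : diag_form (fun=> 0) = 0.
Proof.
by rewrite /diag_form mpolyC0 add0r big1 // => i _; rewrite !mul0r.
Qed.

Lemma diag_formD c d : diag_form (fun i => c i + d i) = diag_form c + diag_form d.
Proof.
rewrite /diag_form addrACA -big_split mpolyCD /=; congr (_ + _).
by apply: eq_bigr => i _; rewrite mpolyCD !mulrDl.
Qed.

Lemma diag_form_delta e i : (i < p)%N ->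
  diag_form (fun j => if j == i then e else 0) =
  e%:MP * (X ^+ i * Y ^+ ((p - i) %% p)).
Proof.
move=> lt_ip; rewrite /diag_form; case: i lt_ip => [|i] lt_ip.
  rewrite eqxx subn0 modnn !mulr1 big_nat_cond big1 ?addr0 //
    => i /andP[/andP[i_gt0 _] _].
  by rewrite gtn_eqF // mpolyC0 !mul0r.
rewrite eq_sym /= mpolyC0 add0r (bigD1_seq i.+1) ?mem_index_iota ?iota_uniq //=.
rewrite eqxx big1_seq ?addr0 => [|j /andP[/negPf-> _]]; last by rewrite mpolyC0 !mul0r.
by rewrite mulrA modn_small //; lia.
Qed.

(** Reducing both exponents modulo p keeps the total degree divisible by p, so
    what remains is a multiple of 1 or of some X^i Y^(p-i). *)
Lemma monomial_diag_form m : (p %| mdeg m)%N ->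
  exists c, idl_eq g h 'X_[m] (diag_form c).
Proof.
have -> : 'X_[m] = X ^+ m ord0 * Y ^+ m ord_max.
  rewrite mpolyXE_id big_ord_recl big_ord1; congr (_ * 'X_ _ ^+ m _); exact: val_inj.
rewrite mdegE big_ord_recl big_ord1 (_ : lift _ _ = ord_max); last exact: val_inj.
move: (m ord0) (m ord_max) => m0 m1 dvd_p.
pose e := (a ^+ p - a) ^+ (m0 %/ p) * (b ^+ p - b) ^+ (m1 %/ p).
exists (fun j => if j == (m0 %% p)%N then e else 0).
rewrite diag_form_delta ?ltn_mod //.
have -> : ((p - m0 %% p) %% p = m1 %% p)%N.
  apply/eqP; rewrite -(eqn_modDl (m0 %% p)) subnKC ?modnn; last by rewrite ltnW ?ltn_mod.
  by rewrite modnDml eq_sym.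
rewrite /e mpolyCM !rmorphXn; exact: idl_eq_redX.
Qed.

Lemma scale_diag_form e c : diag_form (fun i => e * c i) = e%:MP * diag_form c.
Proof.
rewrite /diag_form mulrDr mulr_sumr mpolyCM; congr (_ + _).
by apply: eq_bigr => i _; rewrite mpolyCM !mulrA.
Qed.

(** If the Euler operator kills f modulo the ideal, so does its (p - 1)-st power,
    and f minus the value of that power at f is the part of f of degrees
    divisible by p. *)
Lemma meuler_diag_form f : idl g h (meuler f) ->
  exists c, idl_eq g h f (diag_form c).
Proof.
have EM := @meulerM 2 A => Ef.
have EX (i : 'I_2) (d : A) : meuler ('X_i ^+ p - d%:MP) = 0.
  rewrite raddfB /= meulerC subr0 (derX EM _ (meulerXi _ i)).
  by rewrite -mulr_natr pcharf0 // mulr0.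
have Eit : idl g h (iter p.-1 (@meuler 2 A) f).
  apply: (idl_iter_der EM) => //; try exact: EX.
  by rewrite -ltnS prednK // prime_gt1.
suff [c Hc] : exists c, idl_eq g h (f - iter p.-1 (@meuler 2 A) f) (diag_form c).
  exists c; apply: idl_eq_trans Hc.
  by rewrite /idl_eq opprB addrC subrK.
rewrite iter_meulerE {1}[f]mpolyE -sumrB.
apply: (big_ind (fun q => exists c, idl_eq g h q (diag_form c))).
- exists (fun=> 0); rewrite diag_form0; apply: idl_eq_refl.
- move=> q r [c Hc] [d Hd]; exists (fun i => c i + d i).
  by rewrite diag_formD; apply: idl_eqD.
- move=> m _; rewrite natrXp1_pchar //.
  case: (boolP (p %| mdeg m)%N) => [/monomial_diag_form[c Hc] | _] /=.
    exists (fun i => f@_m * c i).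
    rewrite scale_diag_form mulr0 scale0r subr0 -mul_mpolyC.
    by apply: idl_eqM Hc; apply: idl_eq_refl.
  exists (fun=> 0); rewrite mulr1 subrr diag_form0; apply: idl_eq_refl.
Qed.

(** The theorem over an arbitrary ring of coefficients of characteristic p,
    before division by 1 - (a + b)^(p-1). *)
Lemma lag_mul_addition :
  exists c, idl_eq g h
    ((1 - (a + b) ^+ p.-1)%:MP * (lag p a%:MP X * lag p b%:MP Y))
    (lag p (a + b)%:MP (X + Y) * diag_form c).
Proof.
have EM := @meulerM 2 A.
pose F := lag p a%:MP X * lag p b%:MP Y.
pose H := lag p (- (a + b))%:MP (- (X + Y)).
pose G := lag p (a + b)%:MP (X + Y).
have EXY : meuler (X + Y) = X + Y by rewrite raddfD /= !meulerXi.
have ENXY : meuler (- (X + Y)) = - (X + Y) by rewrite raddfN /= EXY.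
have XYp : (X + Y) ^+ p - ((a + b) ^+ p - (a + b))%:MP = g + h.
  rewrite !exprDn_pchar ?pnatE // /g /h !(mpolyCB, mpolyCD); ring.
have [c Hc] : exists c, idl_eq g h (F * H) (diag_form c).
  apply: meuler_diag_form.
  have E1 := der_lag EM pM (meulerC 2 a) (meulerXi A ord0).
  have E2 := der_lag EM pM (meulerC 2 b) (meulerXi A ord_max).
  have E3 := der_lag EM pM (meulerC 2 (- (a + b))) ENXY.
  have K1 : a%:MP ^+ p - a%:MP = (a ^+ p - a)%:MP_[2] by rewrite mpolyCB rmorphXn.
  have K2 : b%:MP ^+ p - b%:MP = (b ^+ p - b)%:MP_[2] by rewrite mpolyCB rmorphXn.
  have N1p (q : {mpoly A[2]}) : (- q) ^+ p = - q ^+ p.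
    rewrite exprNn -[in (-1) ^+ p](prednK p_gt0) exprS (signr_pred_pchar pM); ring.
  have K3 : (- (X + Y)) ^+ p - ((- (a + b))%:MP ^+ p - (- (a + b))%:MP) = - (g + h).
    rewrite -XYp mpolyCN !N1p mpolyCB rmorphXn; ring.
  rewrite K1 in E1; rewrite K2 in E2; rewrite K3 in E3.
  have NE : - (X + Y) - (- (a + b))%:MP = - (X - a%:MP + (Y - b%:MP)).
    rewrite mpolyCN mpolyCD; move: a%:MP b%:MP => s t; ring.
  rewrite NE in E3.
  exact: (idl_der_mul3 EM E1 E2 E3).
exists c; apply: (@idl_eq_trans _ _ _ _ (G * (F * H))); last first.
  by apply: idl_eqM Hc; apply: idl_eq_refl.
have [w Hw] := lag_mul_opp pA (a + b).
pose ev : {rmorphism {poly A} -> {mpoly A[2]}} :=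
  horner_morph (fun q => mulrC (X + Y) q%:MP_[2]).
have evC d : ev d%:P = d%:MP by exact: horner_morphC.
have evX : ev 'X = X + Y by exact: horner_morphX.
have GH : G * H = (1 - (a + b) ^+ p.-1)%:MP + ev w * (g + h).
  have := congr1 ev Hw.
  rewrite !(rmorphM ev) !(rmorph_lag _ ev) (rmorphN ev) !evC evX.
  by rewrite (rmorphD ev) (rmorphM ev) (rmorphB ev) (rmorphXn ev) !evC evX XYp.
exists (- (F * ev w)), (- (F * ev w)).
have e : G * (F * H) = F * (G * H) by rewrite mulrCA.
rewrite -/F e GH.
move: (1 - _)%:MP (F) (ev w) (g) (h) => s f u k l; ring.
Qed.
End Bivariate.

(** * Reduction modulo p of the Laguerre polynomial *)

(** Although [ratr] is not a ring morphism into a field of positive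
    characteristic, it maps a fraction, reduced or not, to the expected quotient
    as soon as the denominator does not vanish in the field. *)
Lemma ratr_divn (F : fieldType) (z : int) (d : nat) :
  d%:R != 0 :> F -> ratr (d%:R^-1 * z%:~R) = d%:R^-1 * z%:~R :> F.
Proof.
move=> dF; have d_neq0 : d%:R != 0 :> rat.
  by rewrite pnatr_eq0; apply: contraNneq dF => ->.
set x := d%:R^-1 * z%:~R.
have num_den : numq x * d%:Z = z * denq x.
  apply: (@intr_inj rat); rewrite !rmorphM /=.
  have den0 : (denq x)%:~R != 0 :> rat by rewrite intr_eq0 denq_neq0.
  rewrite -(divfK den0 (numq x)%:~R) divq_num_den /x -pmulrn; field.
  exact: d_neq0.
have /dvdzP[k dE] : (denq x %| d%:Z)%Z.
  have : (denq x %| numq x * d%:Z)%Z by rewrite num_den dvdz_mull.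
  by rewrite Gauss_dvdzr // coprimez_sym /coprimez /gcdz (eqP (coprime_num_den x)).
have denF : (denq x)%:~R != 0 :> F.
  apply: contraNneq dF => den0; rewrite -[d%:R]/(d%:Z%:~R) dE rmorphM /= den0.
  by rewrite mulr0.
rewrite /ratr [RHS]mulrC; apply/eqP.
by rewrite eqr_div // -[d%:R]/(d%:Z%:~R) -!rmorphM num_den.
Qed.

(** Here f need not be additive. *)
Lemma mcoeff_map_mpoly0 (n : nat) (R S : nzRingType) (f : R -> S)
    (q : {mpoly R[n]}) m : f 0 = 0 -> (map_mpoly f q)@_m = f q@_m.
Proof.
move=> f0; rewrite /map_mpoly /mmap raddf_sum /=.
have [m_q | m_nq] := boolP (m \in msupp q).
  rewrite (bigD1_seq m) ?msupp_uniq //= big1 ?addr0 => [|m' neq_m].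
    by rewrite mmap1_id mcoeffCM mcoeffX eqxx mulr1.
  by rewrite mmap1_id mcoeffCM mcoeffX (negPf neq_m) mulr0.
rewrite memN_msupp_eq0 // f0 big_seq big1 // => m' m'_q.
rewrite mmap1_id mcoeffCM mcoeffX; case: eqP => [e|_]; last by rewrite mulr0.
by rewrite -e m'_q in m_nq.
Qed.

Lemma bin_pred_pchar (T : comNzRingType) (p k : nat) :
  p \in [pchar T] -> (k < p)%N -> 'C(p.-1, k)%:R = (-1) ^+ k :> T.
Proof.
move=> pT; have p_pr := pcharf_prime pT; elim: k => [|k IHk] lt_kp.
  by rewrite bin0.
have : 'C(p, k.+1)%:R = 0 :> T.
  by apply/eqP; rewrite -(dvdn_pcharf pT) prime_dvd_bin.
rewrite -{1}(prednK (prime_gt0 p_pr)) binS natrD IHk ?(ltnW lt_kp) // exprS.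
by move/eqP; rewrite addr_eq0 mulN1r => /eqP.
Qed.

Section LaguerreModp.
Variables (p : nat) (p_pr : prime p).
Let pF := pchar_Fp p_pr.
Let p_gt0 := prime_gt0 p_pr.

(** The Laguerre polynomial of degree p - 1 multiplied by (p - 1)!, which has
    integer coefficients; (p - 1)! = -1 modulo p by Wilson's theorem. *)
Definition laguerre_int : {mpoly int[2]} :=
  \sum_(k < p.-1.+1) 'C(p.-1, k)%:R *
    \prod_(j < p.-1 - k) ('X_ord0 + p.-1%:R - j%:R) * (- 'X_ord_max) ^+ k.

Lemma laguerre_intE :
  laguerre p.-1 = (p.-1`!%:R^-1 : rat) *: map_mpoly intr laguerre_int.
Proof.
rewrite rmorph_sum scaler_sumr; apply: eq_bigr => k _.
have le_k : (k <= p.-1)%N by rewrite -ltnS.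
rewrite !rmorphM rmorphXn rmorphN rmorph_prod rmorph_nat /= !map_mpolyX.
rewrite /gbinom -scalerAl -scalerAr scalerA.
have natE n (u v : {mpoly rat[2]}) : n%:R * u * v = (n%:R : rat) *: (u * v).
  by rewrite scaler_nat mulr_natl mulrnAl.
rewrite natE scalerA.
congr (_ *: (_ * _)).
  rewrite -(bin_fact le_k) !natrM; set u := k`!%:R; set v := (p.-1 - k)`!%:R.
  have : 'C(p.-1, k)%:R != 0 :> rat by rewrite pnatr_eq0 -lt0n bin_gt0.
  have : u != 0 by rewrite pnatr_eq0 -lt0n fact_gt0.
  have : v != 0 by rewrite pnatr_eq0 -lt0n fact_gt0.
  by move=> v0 u0 c0; field; rewrite u0 v0 c0.
apply: eq_bigr => j _; by rewrite rmorphB rmorphD !rmorph_nat /= map_mpolyX.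
Qed.

Lemma fact_pred_Fp : p.-1`!%:R = -1 :> 'F_p.
Proof.
apply/eqP; rewrite -subr_eq0 opprK natr1 -(dvdn_pcharf pF).
by rewrite -Wilson ?prime_gt1.
Qed.

Lemma laguerre_modpE : laguerre_modp p = lag p 'X_ord0 'X_ord_max.
Proof.
have pM : p \in [pchar {mpoly 'F_p[2]}].
  exact: (rmorph_pchar (@mpolyC 2 'F_p)).
have -> : laguerre_modp p = - map_mpoly intr laguerre_int.
  apply/mpolyP => m; rewrite mcoeff_map_mpoly0; last first.
    by rewrite /ratr (_ : numq 0 = 0) // mul0r.
  rewrite laguerre_intE mcoeffZ mcoeffN !mcoeff_map_mpoly /= ratr_divn.
    by rewrite fact_pred_Fp invrN1 mulN1r.
  by rewrite fact_pred_Fp oppr_eq0 oner_eq0.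
rewrite /lag /laguerre_int prednK // rmorph_sum; congr (- _).
apply: eq_bigr => k _.
rewrite !rmorphM rmorphXn rmorphN rmorph_prod rmorph_nat /= !map_mpolyX.
have -> : 'C(p.-1, k)%:R = (-1) ^+ k :> {mpoly 'F_p[2]}.
  exact: (bin_pred_pchar pM).
rewrite (exprNn 'X_ord_max).
rewrite mulrACA.
rewrite -expr2 sqrr_sign mul1r.
congr (_ * _); apply: eq_bigr => j _.
rewrite rmorphB rmorphD !rmorph_nat /= map_mpolyX -addrA; congr (_ + _).
have -> : p.-1%:R = - 1 :> {mpoly 'F_p[2]} by rewrite -subn1 (pchar_natrN pM).
by rewrite -opprD addrC natr1.
Qed.
End LaguerreModp.

(** * Coefficients in R *)

Lemma ratfunC_is_zmod_morphism p : zmod_morphism (@ratfunC p).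
Proof. by move=> x y; rewrite /ratfunC mpolyCB rmorphB. Qed.

Lemma ratfunC_is_monoid_morphism p : monoid_morphism (@ratfunC p).
Proof. by split=> [|x y]; rewrite /ratfunC ?mpolyCM ?rmorphM ?mpolyC1 ?rmorph1. Qed.

HB.instance Definition _ p := GRing.isZmodMorphism.Build _ _ (@ratfunC p)
  (@ratfunC_is_zmod_morphism p).
HB.instance Definition _ p := GRing.isMonoidMorphism.Build _ _ (@ratfunC p)
  (@ratfunC_is_monoid_morphism p).

Lemma rmorph_scale_comb (S T : comNzRingType) (f : {rmorphism S -> T}) (t : T)
    (x y u v g h : S) :
  x - y = u * g + v * h ->
  t * f x - t * f y = t * f u * f g + t * f v * f h.
Proof. by move=> E; rewrite -mulrBr -rmorphB E rmorphD !rmorphM mulrDr !mulrA. Qed.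

Section RationalFunctions.
Variable p : nat.
Hypothesis p_pr : prime p.
Local Notation K := (ratfun p).
Local Notation s := ((ralpha p + rbeta p) ^+ p.-1 - 1).

Lemma laguerre_atE (a : K) (x : {mpoly K[2]}) :
  laguerre_at a x = lag p a%:MP x.
Proof.
pose ev : {rmorphism {mpoly 'F_p[2]} -> {mpoly K[2]}} :=
  mmap (@mpolyC 2 K \o @ratfunC p) (tnth [tuple a%:MP_[2]; x]).
rewrite /laguerre_at laguerre_modpE //.
have -> : lag p a%:MP x = lag p (ev 'X_ord0) (ev 'X_ord_max).
  by rewrite /ev /= !mmapX !mmap1U.
exact: (rmorph_lag p ev).
Qed.

Lemma in_RD (x y : K) : in_R x -> in_R y -> in_R (x + y).
Proof. by move=> [q ->] [r ->]; exists (q + r); rewrite mmapD. Qed.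

Lemma in_RM (x y : K) : in_R x -> in_R y -> in_R (x * y).
Proof. by move=> [q ->] [r ->]; exists (q * r); rewrite rmorphM. Qed.

Lemma in_RX (x : K) n : in_R x -> in_R (x ^+ n).
Proof. by move=> [q ->]; exists (q ^+ n); rewrite rmorphXn. Qed.

Lemma in_R_ratfunC c : in_R (@ratfunC p c).
Proof. by exists c%:MP; rewrite mmapC. Qed.

Lemma in_RN (x : K) : in_R x -> in_R (- x).
Proof. by move=> [q ->]; exists (- q); rewrite rmorphN. Qed.

Lemma in_R_ralpha : in_R (ralpha p).
Proof. by exists 'X_(inord 0); rewrite mmapX mmap1U (tnth_nth 0) inordK. Qed.

Lemma in_R_rbeta : in_R (rbeta p).
Proof. by exists 'X_(inord 1); rewrite mmapX mmap1U (tnth_nth 0) inordK. Qed.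

Lemma in_R_inv : in_R s^-1.
Proof. by exists 'X_(inord 2); rewrite mmapX mmap1U (tnth_nth 0) inordK. Qed.

(** R contains the polynomials in alpha and beta. *)
Lemma in_R_tofrac (f : {mpoly 'F_p[2]}) : in_R (tofrac f : K).
Proof.
elim/mpolyind: f => [|c m f _ _ IHf].
  by exists 0; rewrite !rmorph0.
rewrite tofracD; apply: in_RD => //.
rewrite -mul_mpolyC mpolyXE_id big_ord_recl big_ord1.
rewrite (_ : lift ord0 ord0 = ord_max); last exact: val_inj.
rewrite !tofracM !tofracXn; apply: in_RM; first exact: in_R_ratfunC.
by apply: in_RM; apply: in_RX; [apply: in_R_ralpha | apply: in_R_rbeta].
Qed.

(** The value of the polynomial at alpha = beta = 0 is -1. *)
Lemma pow_sum_sub1_neq0 : s != 0.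
Proof.
rewrite /ralpha /rbeta -tofracD -tofracXn -tofrac1 -tofracB tofrac_eq0.
apply/eqP => /(congr1 (meval (fun=> 0))).
rewrite rmorphB rmorphXn rmorphD rmorph1 rmorph0 /= !mevalXU addr0 expr0n.
have -> : (p.-1 == 0)%N = false by have := prime_gt1 p_pr; case: (p) => [|[]].
by rewrite sub0r => /eqP; rewrite oppr_eq0 oner_eq0.
Qed.

Local Notation phi := (map_mpoly (@tofrac {mpoly 'F_p[2]})
  : {rmorphism {mpoly {mpoly 'F_p[2]}[2]} -> {mpoly K[2]}}).

Lemma in_RXY_scale (t : K) f : in_R t -> in_RXY (t%:MP * phi f).
Proof.
move=> Rt m; rewrite mcoeffCM /= mcoeff_map_mpoly.
by apply: in_RM => //; apply: in_R_tofrac.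
Qed.
(** A congruence with coefficients in F_p[alpha, beta] can be multiplied by any
    element of R. *)
Lemma congr_RXY_scale (t : K) (g h f1 f2 : {mpoly {mpoly 'F_p[2]}[2]})
    (g' h' f1' f2' : {mpoly K[2]}) :
  in_R t -> g' = phi g -> h' = phi h ->
  f1' = t%:MP * phi f1 -> f2' = t%:MP * phi f2 ->
  idl_eq g h f1 f2 -> congr_RXY g' h' f1' f2'.
Proof.
move=> Rt -> -> -> -> [u [v fE]]; split; try exact: in_RXY_scale.
exists (t%:MP * phi u), (t%:MP * phi v); split; try exact: in_RXY_scale.
exact: (rmorph_scale_comb phi t%:MP fE).
Qed.
End RationalFunctions.

Theorem proposition3p1 (p : nat) (p_prime : prime p) :
  exists c : nat -> ratfun p,
    (forall i : nat, (i < p)%N -> in_R (c i)) /\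
    congr_RXY
      (polX p ^+ p - (ralpha p ^+ p - ralpha p)%:MP_[2])
      (polY p ^+ p - (rbeta p ^+ p - rbeta p)%:MP_[2])
      (laguerre_at (ralpha p) (polX p) * laguerre_at (rbeta p) (polY p))
      (laguerre_at (ralpha p + rbeta p) (polX p + polY p) *
         ((c 0%N)%:MP_[2] +
          \sum_(1 <= i < p) (c i)%:MP_[2] * polX p ^+ i * polY p ^+ (p - i))).
Proof.
pose K := ratfun p; pose A : comNzRingType := {mpoly 'F_p[2]}.
have pA : p \in [pchar A] := rmorph_pchar (@mpolyC 2 'F_p) (pchar_Fp p_prime).
(* a and b are the two indeterminates; only their images in the field of
   rational expressions matter, and leaving a and b opaque keeps terms small. *)
have [a aE] : exists a : A, (tofrac a : K) = ralpha p by exists 'X_ord0.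
have [b bE] : exists b : A, (tofrac b : K) = rbeta p by exists 'X_ord_max.
have [c Hc] := lag_mul_addition pA a b.
pose phi : {rmorphism {mpoly A[2]} -> {mpoly K[2]}} :=
  map_mpoly (@tofrac {mpoly 'F_p[2]}).
have phiC (e : A) : phi e%:MP = (tofrac e : K)%:MP by exact: map_mpolyC.
have phiX i : phi 'X_i = 'X_i by exact: map_mpolyX.
pose t : K := - ((ralpha p + rbeta p) ^+ p.-1 - 1)^-1.
have Rt : in_R t by apply: in_RN; apply: in_R_inv.
have tE : t * tofrac (1 - (a + b) ^+ p.-1) = 1.
  rewrite tofracB tofrac1 tofracXn tofracD aE bE /t mulNr -mulrN opprB.
  by rewrite mulVf // pow_sum_sub1_neq0.
exists (fun i => t * tofrac (c i)); split=> [i _|].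
  by apply: in_RM => //; apply: in_R_tofrac.
have XE : phi 'X_ord0 = polX p := phiX ord0.
have YE : phi 'X_ord_max = polY p := phiX ord_max.
have phiL e z : phi (lag p e%:MP z) = lag p (tofrac e : K)%:MP (phi z).
  by rewrite (rmorph_lag p phi) phiC.
apply: (congr_RXY_scale Rt _ _ _ _ Hc).
- by rewrite (rmorphB phi) (rmorphXn phi) XE phiC tofracB tofracXn aE.
- by rewrite (rmorphB phi) (rmorphXn phi) YE phiC tofracB tofracXn bE.
- rewrite !(laguerre_atE p_prime) (rmorphM phi) phiC mulrA -mpolyCM tE mpolyC1.
  rewrite [RHS]mul1r [RHS](rmorphM phi).
  congr (_ * _).
    by rewrite [RHS]phiL XE aE.
  by rewrite [RHS]phiL YE bE.
- rewrite (laguerre_atE p_prime) (rmorphM phi) (phiL (a + b)) (rmorphD phi) XE YE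
    tofracD aE bE mulrCA.
  congr (_ * _).
  rewrite /diag_form (rmorphD phi) (rmorph_sum phi) mulrDr phiC.
  rewrite -mpolyCM mulr_sumr; congr (_ + _); apply: eq_bigr => i _.
  by rewrite !(rmorphM phi) !(rmorphXn phi) XE YE phiC mpolyCM !mulrA.
Qed.
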